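(* Let $H=(V,S)$ be a signed hypergraph, and assume that the underlying hypergraph of $H$ has a $\beta$-leaf $v$. Let $s_1\subseteq s_2\subseteq\cdots\subseteq s_k$ ($k\ge 1$) be the signed edges of $H$ containing $v$, and assume that $S$ contains all the signed edges $s_i-v$ such that $|s_i-v|\ge 2$, for $i\in\{1,\dots,k\}$. Define $H_1:=(V_1,S_v\cup P_v)$, where $V_1$ is the underlying edge of $s_k$, $S_v:=\{s_1,\dots,s_k\}$ and $P_v:=\{s_i-v:\ |s_i-v|\ge 2,\ i\in\{1,\dots,k\}\}$, and define $H_2:=H-v$. Then the pseudo-Boolean polytope $\mathcal P_{pB}(H)$ is decomposable into the pseudo-Boolean polytopes $\mathcal P_{pB}(H_1)$ and $\mathcal P_{pB}(H_2)$.
   Context: A hypergraph is a pair $(V,E)$ with $V$ a finite set of nodes and $E$ a set of edges, which are subsets of $V$ of cardinality at least two. A signed hypergraph $H$ is a pair $(V,S)$ with $V$ a finite set of nodes and $S$ a set of signed edges. A signed edge is a pair $s=(e,\eta_s)$ with $e\subseteq V$, $|e|\ge 2$, and $\eta_s:e\to\{-1,+1\}$; $e$ is its underlying edge. No two signed edges of $S$ are identical (same $e$ and same $\eta_s$), but signed edges may be parallel (same $e$). Set-theoretic notation for $s$ refers to its underlying edge: $|s|:=|e|$, $v\in s$ means $v\in e$, and $s\subseteq s'$ refers to containment of the underlying edges. The underlying hypergraph of $H$ is obtained by ignoring signs and dropping parallel edges. For $v\in s$, $s-v$ denotes the pair $(e\setminus\{v\},\eta_s|_{e\setminus\{v\}})$.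 The signed hypergraph $H-v$ has node set $V\setminus\{v\}$ and set of signed edges $\{s-v: s\in S,\ |s-v|\ge 2\}$, where $s-v:=s$ if $v\notin s$. A node $v$ is a $\beta$-leaf of a hypergraph if the set of its edges containing $v$ is totally ordered by inclusion. For a signed edge $s$ and $v\in s$, let $\sigma_s(z_v):=z_v$ if $\eta_s(v)=+1$ and $\sigma_s(z_v):=1-z_v$ if $\eta_s(v)=-1$. The pseudo-Boolean set is $\mathcal S_{pB}(H):=\{z\in\{0,1\}^{V\cup S}: z_s=\prod_{v\in s}\sigma_s(z_v)\ \forall s\in S\}$, and the pseudo-Boolean polytope $\mathcal P_{pB}(H)$ is its convex hull. Decomposability: let $V=V_1\cup V_2$, $S=S_1\cup S_2$ with every signed edge in $S_i$ contained in $V_i$, and $H_i=(V_i,S_i)$, $i=1,2$. Write a vector $z\in\mathbb R^{V\cup S}$ as $(z^1,z^\cap,z^2)$, where $z^\cap$ contains the components corresponding to nodes and signed edges that are in both $H_1$ and $H_2$, $z^1$ those in $H_1$ but not in $H_2$, and $z^2$ those in $H_2$ but not in $H_1$. Then $\mathcal P_{pB}(H)$ is decomposable into $\mathcal P_{pB}(H_1)$ and $\mathcal P_{pB}(H_2)$ if $$(z^1,z^\cap)\in\mathcal P_{pB}(H_1),\ (z^\cap,z^2)\in\mathcal P_{pB}(H_2)\ \Rightarrow\ (z^1,z^\cap,z^2)\in\mathcal P_{pB}(H).$$ *)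

(* Defs.v *)
From mathcomp Require Import all_boot all_order all_algebra.
From mathcomp Require Import reals.

Set Implicit Arguments.
Unset Strict Implicit.
Unset Printing Implicit Defensive.

Import Order.TTheory GRing.Theory Num.Theory.
Local Open Scope ring_scope.

(* All (signed) hypergraphs have their nodes in a common finite type T. *)

Record hypergraph (T : finType) := Hypergraph {
  hnodes : {set T};
  hedges : {set {set T}} }.

Definition beta_leaf (T : finType) (G : hypergraph T) (v : T) : Prop :=
  v \in hnodes G /\
  {in [set e in hedges G | v \in e] &, forall e f : {set T},
     (e \subset f) || (f \subset e)}.

(* A pair (e, eta) with eta : e -> {-1, +1} is encoded as the partial function
   eta on T, whose domain determines e: s u = Some true if u is in e and
   eta u = +1, s u = Some false if u is in e and eta u = -1, and s u = None if
   u is not in e.  The condition |e| >= 2 is imposed in is_signed_hypergraph,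
   since s - v may violate it. *)
Definition sedge (T : finType) : finType := {ffun T -> option bool}.

Definition uedge (T : finType) (s : sedge T) : {set T} :=
  [set u | s u != None].

Definition sedge_del (T : finType) (s : sedge T) (v : T) : sedge T :=
  [ffun u => if u == v then None else s u].

Record signed_hypergraph (T : finType) := SignedHypergraph {
  nodes : {set T};
  sedges : {set sedge T} }.

Definition is_signed_hypergraph (T : finType) (H : signed_hypergraph T) : Prop :=
  {in sedges H, forall s, uedge s \subset nodes H /\ (2 <= #|uedge s|)%N}.

Definition underlying (T : finType) (H : signed_hypergraph T) : hypergraph T :=
  Hypergraph (nodes H) [set uedge s | s in sedges H].

Definition node_del (T : finType) (H : signed_hypergraph T) (v : T) :
    signed_hypergraph T :=
  SignedHypergraph (nodes H :\ v)
    [set sedge_del s v | s in sedges H & (2 <= #|uedge (sedge_del s v)|)%N].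

(* The index set V u S of the coordinates. *)
Definition coords (T : finType) (H : signed_hypergraph T) : {set T + sedge T} :=
  [set c | match c with inl u => u \in nodes H | inr s => s \in sedges H end].

Definition cindex (T : finType) (H : signed_hypergraph T) : finType :=
  {c : T + sedge T | c \in coords H}.

(* R^(V u S) *)
Definition vect (R : realType) (T : finType) (H : signed_hypergraph T) : Type :=
  {ffun cindex H -> R}.

(* The component of z at c; the value 0 outside of coords H is a dummy. *)
Definition entry (R : realType) (T : finType) (H : signed_hypergraph T)
    (z : vect R H) (c : T + sedge T) : R :=
  if insub c is Some i then z i else 0.

(* The components of z that belong to K; only used when coords K is contained
   in coords H. *)
Definition restrict (R : realType) (T : finType) (H K : signed_hypergraph T)
    (z : vect R H) : vect R K :=
  [ffun c : cindex K => entry z (val c)].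

(* sigma_s(x) at the node u, meaningful for u in s. *)
Definition sigma (R : realType) (T : finType) (s : sedge T) (u : T) (x : R) : R :=
  if s u == Some true then x else 1 - x.

Definition pB_set (R : realType) (T : finType) (H : signed_hypergraph T)
    (z : vect R H) : Prop :=
  (forall c, z c = 0 \/ z c = 1) /\
  {in sedges H, forall s,
     entry z (inr s) = \prod_(u in uedge s) sigma s u (entry z (inl u))}.

Definition conv_hull (R : realType) (I : finType) (X : {ffun I -> R} -> Prop)
    (z : {ffun I -> R}) : Prop :=
  exists (m : nat) (w : 'I_m -> R) (x : 'I_m -> {ffun I -> R}),
    [/\ forall j, 0 <= w j,
        \sum_j w j = 1,
        forall j, X (x j)
      & forall i, z i = \sum_j w j * x j i].

Definition pB_polytope (R : realType) (T : finType) (H : signed_hypergraph T) :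
    vect R H -> Prop :=
  conv_hull (@pB_set R T H).

Definition decomposable (R : realType) (T : finType)
    (H H1 H2 : signed_hypergraph T) : Prop :=
  [/\ is_signed_hypergraph H1,
      is_signed_hypergraph H2,
      nodes H = nodes H1 :|: nodes H2,
      sedges H = sedges H1 :|: sedges H2
    & forall z : vect R H,
        pB_polytope (restrict H1 z) -> pB_polytope (restrict H2 z) ->
        pB_polytope z].

(* Main.v *)
Require Import Defs.
From mathcomp Require Import all_boot all_order all_algebra.
From mathcomp Require Import reals.

(** Read a point of a pseudo-Boolean polytope as a probability distribution on
    0/1 assignments of the nodes: its coordinates are the probabilities that a
    node is 1, and that all the literals of a signed edge hold.  Let [A_i] be
    the event that all the literals of [s_i - v] hold.  The only information
    about the nodes other than [v] that enters the coordinates of [H1] lost in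
    [H2] is which of the [A_i] occur: once this is known, such a coordinate
    depends on the node [v] only.

    So it is enough to find a joint distribution of an assignment [x] drawn
    from the first distribution and an assignment [y] drawn from the second
    one, such that [x] and [y] almost surely belong to the same events [A_i]:
    the assignment that takes the value of [v] from [x] and all others from [y]
    then has the required coordinates ([glue_pB_set]).  Such a coupling exists
    as soon as the two distributions give the same probability to each atom of
    the Boolean algebra generated by the [A_i] ([coupling]).

    The two distributions agree on each [A_i]: this probability is a common
    coordinate, [s_i - v] or a single node ([agree_mass]).  That they agree on
    atoms is where the [beta]-leaf matters.  As the [s_i] form a chain, two
    events [A_i] and [A_j] are nested or disjoint ([agree_nested]), so the
    events [A_i], the empty and the sure event are stable under intersection;
    inclusion-exclusion then expresses the probability of an atom through
    probabilities of these events ([null_on_atoms]). *)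

Set Implicit Arguments.
Unset Strict Implicit.
Unset Printing Implicit Defensive.

Import Order.TTheory GRing.Theory Num.Theory.
Local Open Scope ring_scope.

(** * Finite distributions *)

(** The convex hull is defined with weights indexed by an ordinal and with
    every point in [X]; couplings produce pairs of indices, some of weight zero
    whose point is not in [X]. *)
Lemma conv_hull_supp (R : realType) (I J : finType)
    (X : {ffun I -> R} -> Prop) (w : J -> R) (x : J -> {ffun I -> R})
    (z : {ffun I -> R}) :
  (forall j, 0 <= w j) -> \sum_j w j = 1 -> (forall j, w j != 0 -> X (x j)) ->
  (forall i, z i = \sum_j w j * x j i) -> conv_hull X z.
Proof.
move=> w0 w1 Xx zE.
have [j0 wj0 | wN] := pickP (fun j => w j != 0); last first.
  have /eqP := w1; rewrite big1 ?(eq_sym 0) ?oner_eq0 // => j _.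
  by apply/eqP; move: (wN j) => /negbFE.
pose x' j := if w j == 0 then x j0 else x j.
exists #|J|, (fun j => w (enum_val j)), (fun j => x' (enum_val j)); split.
- by [].
- by rewrite -w1 [RHS](reindex _ (onW_bij _ (@enum_val_bij J))).
- by move=> j; rewrite /x'; case: eqP => [_ | /eqP]; [apply: Xx | apply: Xx].
- move=> i; rewrite zE (reindex _ (onW_bij _ (@enum_val_bij J))) /=.
  apply: eq_bigr => j _; rewrite /x'.
  by case: eqP => // ->; rewrite !mul0r.
Qed.

(** Draw [i] from [w], then [j] from [u] conditioned on [b j = a i].  Where this
    condition has probability zero, [i] has weight zero as well. *)
Lemma coupling (R : realFieldType) (I J K : finType) (w : I -> R) (u : J -> R)
    (a : I -> K) (b : J -> K) :
  (forall i, 0 <= w i) -> (forall j, 0 <= u j) ->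
  (forall c, \sum_(i | a i == c) w i = \sum_(j | b j == c) u j) ->
  exists p : I * J -> R,
    [/\ forall ij, 0 <= p ij,
        forall ij, p ij != 0 -> a ij.1 = b ij.2,
        forall i, \sum_j p (i, j) = w i
      & forall j, \sum_i p (i, j) = u j].
Proof.
move=> w0 u0 wu; pose q c := \sum_(i | a i == c) w i.
exists (fun ij => if a ij.1 == b ij.2 then w ij.1 * u ij.2 / q (a ij.1) else 0).
split=> [[i j] | [i j] | i | j] /=.
- by case: ifP => // _; rewrite divr_ge0 ?mulr_ge0 ?sumr_ge0.
- by case: (a i =P b j) => // _; rewrite eqxx.
- rewrite -big_mkcond /= (eq_bigl (fun j => b j == a i)); last first.
    by move=> j; rewrite eq_sym.
  rewrite -mulr_suml -mulr_sumr -wu -/(q _).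
  have [q0|q0] := eqVneq (q (a i)) 0; last by rewrite mulfK.
  rewrite q0 mulr0 mul0r; apply/esym/(psumr_eq0P _ q0); last exact: eqxx.
  by move=> ? _.
- rewrite -big_mkcond /=.
  rewrite (eq_bigr (fun i => w i * (u j / q (b j)))); last first.
    by move=> i /eqP ->; rewrite mulrA.
  rewrite -mulr_suml -/(q _).
  have [q0|q0] := eqVneq (q (b j)) 0; last by rewrite mulrC divfK.
  rewrite q0 mul0r; move: q0; rewrite /q wu => q0.
  apply/esym/(psumr_eq0P _ q0); last exact: eqxx.
  by move=> ? _.
Qed.

(** A finite, signed form of the uniqueness of a measure given on a system of
    sets stable under intersection: a condition [x \notin A k] is the difference
    of no condition and of the condition [x \in A k], and the latter only
    replaces [B] by [B :&: A k]. *)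
Lemma null_on_atoms (V : zmodType) (T K : finType) (d : T -> V)
    (P : {set T} -> Prop) (A : K -> {set T}) (a : K -> bool) (B : {set T}) :
  (forall C D, P C -> P D -> P (C :&: D)) ->
  (forall C, P C -> \sum_(x in C) d x = 0) ->
  (forall k, P (A k)) -> P B ->
  \sum_(x in B | [forall k, (x \in A k) == a k]) d x = 0.
Proof.
move=> PI P0 PA.
suff H r C : P C ->
    \sum_(x in C | all (fun k => (x \in A k) == a k) r) d x = 0.
  move=> /(H (enum K)); apply: etrans; apply: eq_bigl => x; congr (_ && _).
  apply/forallP/allP => [h k _ | h k]; first exact: h.
  by apply: h; rewrite mem_enum.
elim: r C => [|k r IHr] C PC /=.
  by rewrite -[RHS](P0 C PC); apply: eq_bigl => x; rewrite andbT.
have in_A : \sum_(x in C | (x \in A k) && all (fun k => (x \in A k) == a k) r)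
    d x = 0.
  rewrite -[RHS](IHr (C :&: A k)); last exact: PI.
  by apply: eq_bigl => x; rewrite inE andbA.
case: (a k) => /=.
  by rewrite -[RHS]in_A; apply: eq_bigl => x; rewrite eqb_id.
have := IHr C PC; rewrite (bigID (fun x => x \in A k)) /=.
rewrite (eq_bigl (fun x => (x \in C) &&
   ((x \in A k) && all (fun k => (x \in A k) == a k) r))); last first.
  by move=> x; rewrite -andbA; congr (_ && _); rewrite andbC.
rewrite in_A add0r; apply: etrans; apply: eq_bigl => x.
by rewrite -andbA eqbF_neg; congr (_ && _); rewrite andbC.
Qed.

(** * Deleting a node from a signed edge *)

Section SignedEdges.

Variable T : finType.
Implicit Types (s t p : sedge T) (u v : T) (H K : signed_hypergraph T).

Lemma uedge_del s v : uedge (sedge_del s v) = uedge s :\ v.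
Proof. by apply/setP=> u; rewrite !inE ffunE; case: (u == v). Qed.

Lemma sedge_del_id s v : v \notin uedge s -> sedge_del s v = s.
Proof.
rewrite inE negbK => /eqP sv; apply/ffunP => u; rewrite ffunE.
by case: eqP => // ->.
Qed.

Lemma node_del_sedge H v t : is_signed_hypergraph H -> t \in sedges H ->
  v \notin uedge t -> t \in sedges (node_del H v).
Proof.
move=> HH tH vt; apply/imsetP; exists t; last by rewrite sedge_del_id.
by rewrite inE tH sedge_del_id //; case: (HH t tH).
Qed.

Lemma node_del_sedgeN H v t : t \in sedges (node_del H v) -> v \notin uedge t.
Proof. by case/imsetP => r _ ->; rewrite uedge_del setD11. Qed.

Variable R : realType.

(** * Coordinates *)

Lemma entryE H (z : vect R H) (c : cindex H) : entry z (val c) = z c.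
Proof. by rewrite /entry valK. Qed.

Lemma entry_ffun H (f : T + sedge T -> R) c : c \in coords H ->
  entry ([ffun i : cindex H => f (val i)] : vect R H) c = f c.
Proof.
by move=> cH; rewrite -[c]/(val (Sub c cH : cindex H)) entryE ffunE.
Qed.

Lemma entry_01 H (z : vect R H) c : (forall i, z i = 0 \/ z i = 1) ->
  entry z c = 0 \/ entry z c = 1.
Proof. by move=> z01; rewrite /entry; case: insub => [i|]; [|left]. Qed.

Lemma entry_conv H K (z : vect R H) (I : finType) (w : I -> R)
    (x : I -> vect R K) :
  (forall i, restrict K z i = \sum_j w j * x j i) ->
  forall c, c \in coords K -> entry z c = \sum_j w j * entry (x j) c.
Proof.
move=> zE c cK; rewrite -[LHS](entry_ffun (entry z) cK).
rewrite -[c in LHS]/(val (Sub c cK : cindex K)) entryE zE.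
by apply: eq_bigr => j _; rewrite -entryE.
Qed.

(** * Signed edges as events *)

(** All the literals of [p] hold at [z]. *)
Definition agree p H (z : vect R H) : bool :=
  [forall u in uedge p, entry z (inl u) == (p u == Some true)%:R].

Lemma sigma_01 p u (x : R) : x = 0 \/ x = 1 ->
  sigma p u x = (x == (p u == Some true)%:R)%:R.
Proof.
have n01 : (0 == 1 :> R) = false by rewrite eq_sym oner_eq0.
by rewrite /sigma; case=> ->; case: (p u == _);
  rewrite ?subr0 ?subrr ?eqxx ?oner_eq0 ?n01.
Qed.

Lemma prod_sigma_agree p H (z : vect R H) : (forall i, z i = 0 \/ z i = 1) ->
  \prod_(u in uedge p) sigma p u (entry z (inl u)) = (agree p z)%:R.
Proof.
move=> z01; have [/forall_inP h|] := boolP (agree p z).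
  by apply: big1 => u /h e; rewrite sigma_01 ?e //; exact: entry_01.
rewrite negb_forall_in => /exists_inP[u up /negPf ne].
by rewrite (bigD1 u) //= sigma_01 ?ne ?mul0r //; exact: entry_01.
Qed.

(** If the literals of [p] and [t] hold together at one point, then [p] and [t]
    have the same signs on their common nodes, so [t] implies [p]. *)
Lemma agree_nested p t H K (x : vect R H) (y : vect R K) :
  uedge p \subset uedge t -> agree p x -> agree t x -> agree t y -> agree p y.
Proof.
move=> /subsetP pt /forall_inP px /forall_inP tx /forall_inP ty.
apply/forall_inP => u up.
have /eqP := px _ up; have /eqP -> := tx _ (pt _ up).
by have /eqP -> := ty _ (pt _ up) => ->.
Qed.

(** An edge with a single node has no coordinate of its own, but then the
    probability of its event is an affine function of a node coordinate. *)
Lemma agree_mass p H K (z : vect R H) (I : finType) (w : I -> R)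
    (x : I -> vect R K) :
  (forall i, restrict K z i = \sum_j w j * x j i) -> \sum_j w j = 1 ->
  (forall j, pB_set (x j)) ->
  uedge p \subset nodes K -> (0 < #|uedge p|)%N ->
  ((2 <= #|uedge p|)%N -> p \in sedges K) ->
  \sum_(j | agree p (x j)) w j =
    if (2 <= #|uedge p|)%N then entry z (inr p)
    else \prod_(u in uedge p) sigma p u (entry z (inl u)).
Proof.
move=> zE w1 xX pK p0 p2.
have massE : \sum_(j | agree p (x j)) w j =
    \sum_j w j * \prod_(u in uedge p) sigma p u (entry (x j) (inl u)).
  rewrite big_mkcond /=; apply: eq_bigr => j _.
  rewrite prod_sigma_agree; last by case: (xX j).
  by case: ifP; rewrite ?mulr1 ?mulr0.
rewrite massE; case: ifP => [/p2 pS | /negbT pN2].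
  rewrite (entry_conv zE) ?inE //; apply: eq_bigr => j _.
  by case: (xX j) => _ ->.
have /cards1P[u pu] : #|uedge p| == 1%N by rewrite eqn_leq p0 leqNgt pN2.
have uK : inl u \in coords K by rewrite inE (subsetP pK) ?pu ?set11.
rewrite pu big_set1 (entry_conv zE) //.
under eq_bigr do rewrite big_set1.
rewrite /sigma; case: ifP => // _.
by under eq_bigr do rewrite mulrBr mulr1; rewrite sumrB w1.
Qed.

(** * Gluing along a beta-leaf *)

Definition glue H H1 H2 (x : vect R H1) (y : vect R H2) : vect R H :=
  [ffun c : cindex H =>
     if val c \in coords H2 then entry y (val c) else entry x (val c)].

(** A signed edge that avoids [v] is read off [y] together with all its nodes.
    One that contains [v] keeps its value in [x]: it is the literal of [v],
    taken from [x], times an event on which [x] and [y] agree. *)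
Lemma glue_pB_set H H1 v (x : vect R H1) (y : vect R (node_del H v)) :
  is_signed_hypergraph H -> pB_set x -> pB_set y -> v \in nodes H ->
  (forall t, t \in sedges H -> v \in uedge t ->
     t \in sedges H1 /\ agree (sedge_del t v) x = agree (sedge_del t v) y) ->
  pB_set (glue H x y).
Proof.
move=> HH [x01 xS] [y01 yS] vH xy; split.
  by move=> c; rewrite ffunE; case: ifP => _; exact: entry_01.
pose f c := if c \in coords (node_del H v) then entry y c else entry x c.
have gE c : c \in coords H -> entry (glue H x y) c = f c.
  exact: (entry_ffun f).
move=> t tH; have [/subsetP tn t2] := HH t tH.
have gy u : u \in uedge t -> u != v ->
    entry (glue H x y) (inl u) = entry y (inl u).
  move=> ut uv; have uH := tn u ut.
  by rewrite gE ?inE // /f !inE uv uH.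
rewrite gE ?inE // /f.
have [vt|vt] := boolP (v \in uedge t); last first.
  have t2H := node_del_sedge HH tH vt.
  rewrite inE t2H yS //; apply: eq_bigr => u ut; rewrite gy //.
  by apply: contraNneq vt => <-.
rewrite inE; case: ifP => [/node_del_sedgeN|_]; first by rewrite vt.
have [tH1 txy] := xy t tH vt.
rewrite xS // (bigD1 v) //= [RHS](bigD1 v) //=.
rewrite gE ?inE // /f !inE eqxx /=; congr (_ * _).
have delE H' (z : vect R H') : (forall i, z i = 0 \/ z i = 1) ->
    \prod_(u in uedge t | u != v) sigma t u (entry z (inl u)) =
    (agree (sedge_del t v) z)%:R.
  move=> z01; rewrite -prod_sigma_agree // uedge_del.
  apply: eq_big => [u|u /andP[_ /negPf uv]]; first by rewrite in_setD1 andbC.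
  by rewrite /sigma ffunE uv.
rewrite delE // txy -delE //.
by apply: eq_bigr => u /andP[ut uv]; rewrite gy.
Qed.

End SignedEdges.

Theorem theorem1 (R : realType) (T : finType) (H : signed_hypergraph T)
    (HH : is_signed_hypergraph H)
    (v : T) (v_leaf : beta_leaf (underlying H) v)
    (k : nat) (s : 'I_k.+1 -> sedge T)
    (s_inj : injective s)
    (s_star : forall t : sedge T,
       (t \in sedges H /\ v \in uedge t) <-> exists i, t = s i)
    (s_incr : forall i j : 'I_k.+1,
       (i <= j)%N -> uedge (s i) \subset uedge (s j))
    (s_del : forall i, (2 <= #|uedge (sedge_del (s i) v)|)%N ->
       sedge_del (s i) v \in sedges H) :
  let Sv := [set s i | i : 'I_k.+1] in
  let Pv := [set sedge_del (s i) v | i : 'I_k.+1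
               & (2 <= #|uedge (sedge_del (s i) v)|)%N] in
  let H1 := SignedHypergraph (uedge (s ord_max)) (Sv :|: Pv) in
  let H2 := node_del H v in
  decomposable R H H1 H2.
Proof.
move=> Sv Pv H1 H2.
have sH i : s i \in sedges H /\ v \in uedge (s i) by apply/s_star; exists i.
have s_top i : uedge (s i) \subset uedge (s ord_max) by apply: s_incr; exact: leq_ord.
have p_top i : uedge (sedge_del (s i) v) \subset uedge (s ord_max).
  by rewrite uedge_del (subset_trans (subsetDl _ _)).
have vH : v \in nodes H.
  by have [h1 h2] := sH ord_max; have [/subsetP/(_ _ h2)] := HH _ h1.
have nodesU : nodes H = nodes H1 :|: nodes H2.
  apply/setP => u; rewrite in_setU in_setD1 /=.
  have [->|uv] /= := eqVneq u v; first by rewrite vH (sH ord_max).2.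
  apply/idP/orP => [|[|//]]; first by right.
  by have [/subsetP/(_ u)] := HH _ (sH ord_max).1.
have sedgesU : sedges H = sedges H1 :|: sedges H2.
  apply/setP => t; apply/idP/idP => [tH|].
    have [vt|vt] := boolP (v \in uedge t); last first.
      by rewrite in_setU (node_del_sedge HH) ?orbT.
    have [i ->] : exists i, t = s i by apply/s_star.
    by rewrite in_setU in_setU imset_f.
  rewrite !in_setU => /orP[/orP[]|].
  - by case/imsetP=> i _ ->; case: (sH i).
  - by case/imsetP=> i; rewrite inE => hi ->; exact: s_del.
  - case/imsetP=> r; rewrite inE => /andP[rH r2] ->.
    have [vr|vr] := boolP (v \in uedge r); last by rewrite sedge_del_id.
    have [i ri] : exists i, r = s i by apply/s_star.
    by rewrite ri; apply: s_del; rewrite -ri.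
split=> //.
- move=> t; rewrite in_setU => /orP[] /imsetP[i] hi ->; split=> //=.
    by case: (HH _ (sH i).1).
  by move: hi; rewrite inE.
- move=> t /imsetP[r]; rewrite inE => /andP[rH r2] ->; split=> //.
  by rewrite uedge_del /= setSD //; case: (HH r rH).
move=> z [m [w [x [w0 w1 xX zx]]]] [n [u [y [u0 u1 yX zy]]]].
pose p i := sedge_del (s i) v.
(* A signed measure on the disjoint union of the two sample spaces: it vanishes
   on an event when the two distributions agree on it. *)
pose d (a : 'I_m + 'I_n) := match a with inl i => w i | inr j => - u j end.
pose ag i (a : 'I_m + 'I_n) :=
  match a with inl j => agree (p i) (x j) | inr j => agree (p i) (y j) end.
pose A i := [set a | ag i a].
have agN (i j : 'I_k.+1) a b : (i <= j)%N -> ag i a -> ag j a -> ag j b -> ag i b.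
  move=> ij; have pij : uedge (p i) \subset uedge (p j).
    by rewrite !uedge_del setSD // s_incr.
  by case: a => a; case: b => b; exact: agree_nested.
(* Stable under intersection because the edges [s i] form a chain. *)
pose P (C : {set 'I_m + 'I_n}) := [\/ C = setT, C = set0 | exists i, C = A i].
have PAA (i j : 'I_k.+1) : (i <= j)%N -> P (A i :&: A j).
  move=> ij; have [->|[a]] := set_0Vmem (A i :&: A j); first by apply: Or32.
  rewrite !inE => /andP[ai aj]; apply: Or33; exists j.
  by apply/setIidPr/subsetP => b; rewrite !inE; exact: agN ij ai aj.
have PI C D : P C -> P D -> P (C :&: D).
  case=> [->|->|[i ->]]; rewrite ?setTI ?set0I //; first by move=> _; apply: Or32.
  case=> [->|->|[j ->]]; rewrite ?setIT ?setI0; [| by apply: Or32 |].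
    by apply: Or33; exists i.
  by have [/PAA//|/ltnW ji] := leqP i j; rewrite setIC; exact: PAA.
have dE (C : pred ('I_m + 'I_n)) : \sum_(a | C a) d a =
    \sum_(i | C (inl i)) w i - \sum_(j | C (inr j)) u j.
  by rewrite big_sumType /= sumrN.
have P0 C : P C -> \sum_(a in C) d a = 0.
  case=> [->|->|[i ->]]; rewrite ?big_set0 //.
    rewrite (eq_bigl predT) => [|a]; last by rewrite inE.
    by rewrite dE w1 u1 subrr.
  under eq_bigl do rewrite inE.
  rewrite dE /=.
  have p0 : (0 < #|uedge (p i)|)%N.
    have [_] := HH _ (sH i).1.
    by rewrite uedge_del (cardsD1 v) (sH i).2.
  rewrite (agree_mass zx) // ?(agree_mass zy) ?subrr //.
  - by rewrite uedge_del setSD //; case: (HH _ (sH i).1).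
  - by move=> /s_del h; apply: node_del_sedge => //; rewrite uedge_del setD11.
  - exact: p_top.
  - by move=> h; rewrite in_setU (imset_f (fun i => sedge_del (s i) v)) ?inE ?orbT.
pose atom a := [ffun i => ag i a].
have same_atoms c : \sum_(i | atom (inl i) == c) w i =
    \sum_(j | atom (inr j) == c) u j.
  apply/eqP; rewrite -subr_eq0 -(dE (fun a => atom a == c)); apply/eqP.
  have PA i : P (A i) by apply: Or33; exists i.
  have PT : P setT by apply: Or31.
  rewrite -[RHS](null_on_atoms c PI P0 PA PT).
  apply: eq_bigl => a; rewrite inE /=; apply/eqP/forallP => [<- i|h].
    by rewrite inE ffunE.
  by apply/ffunP => i; have /eqP <- := h i; rewrite inE ffunE.
have [q [q0 qat qw qu]] := coupling w0 u0 same_atoms.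
apply: (conv_hull_supp (w := q) (x := fun ij => glue H (x ij.1) (y ij.2))) => //.
- rewrite (eq_bigr (fun ij => q (ij.1, ij.2))) => [|[]//].
  rewrite -(pair_bigA _ (fun i j => q (i, j))) /= -w1.
  by apply: eq_bigr => i _.
- move=> [i j] /qat /= /ffunP at_eq; apply: glue_pB_set => // t tH vt.
  have [l ->] : exists l, t = s l by apply/s_star.
  by split; [rewrite /= in_setU imset_f | have := at_eq l; rewrite !ffunE].
move=> c; rewrite (eq_bigr (fun ij => q (ij.1, ij.2) *
    if val c \in coords H2 then entry (y ij.2) (val c)
    else entry (x ij.1) (val c))) => [|[i j] _]; last by rewrite ffunE.
rewrite -(pair_bigA _ (fun i j => q (i, j) *
  if val c \in coords H2 then entry (y j) (val c) else entry (x i) (val c))) /=.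
rewrite -entryE; have [cH2|cH2] := boolP (val c \in coords H2).
  rewrite (entry_conv zy cH2) [RHS]exchange_big /=.
  by apply: eq_bigr => j _; rewrite -mulr_suml qu.
have cH1 : val c \in coords H1.
  have := valP c; move: cH2; rewrite !in_set.
  by case: (val c) => a /negPf; rewrite ?nodesU ?sedgesU in_setU => ->; rewrite orbF.
rewrite (entry_conv zx cH1).
by apply: eq_bigr => i _; rewrite -mulr_suml qw.
Qed.
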